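(* Let $X_1,X_2,\ldots$ be integrable positively associated random variables, let $S_n=\sum_{i=1}^nX_i$, and let $\tau$ be a bounded stopping time. (a) If $I\{\tau\le j\}$ is a componentwise nondecreasing function of $S_1,\ldots,S_j$ for every $j\ge1$, then $$E(S_\tau)\le E\left(\sum_{i=1}^{\tau}E(X_i)\right).$$ (b) If $I\{\tau\le j\}$ is a componentwise nonincreasing function of $S_1,\ldots,S_j$ for every $j\ge1$, then $$E(S_\tau)\ge E\left(\sum_{i=1}^{\tau}E(X_i)\right).$$
   Context: Functions are understood to be Borel measurable; $I\{A\}$ is the indicator of $A$. A finite collection $X_1,\ldots,X_n$ of random variables is (positively) associated if $\operatorname{Cov}(f(X_1,\ldots,X_n),g(X_1,\ldots,X_n))\ge0$ for all componentwise nondecreasing functions $f,g$ on $\mathbb{R}^n$ for which the covariance is defined; an infinite collection is associated if every finite subcollection is. A stopping time is a random variable $\tau$ with values in $\{1,2,\ldots\}\cup\{\infty\}$ with $\{\tau\le j\}\in\sigma(S_1,\ldots,S_j)$ for every $j\ge1$; it is bounded if $\tau\le M$ a.s. for some $M\in\mathbb{N}$. ''$I\{\tau\le j\}$ is a componentwise nondecreasing (nonincreasing) function of $S_1,\ldots,S_j$'' means $I\{\tau\le j\}=h_j(S_1,\ldots,S_j)$ for some componentwise nondecreasing (nonincreasing) function $h_j$ on $\mathbb{R}^j$. For a deterministic sequence $(a_i)_{i\ge1}$, $\sum_{i=1}^{\tau}a_i:=\sum_{i=1}^{\infty}a_iI\{\tau\ge i\}$; thus if $\tau\le M$ a.s.,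 $E(\sum_{i=1}^\tau a_i)=\sum_{i=1}^M a_iP(\tau\ge i)$. Here $a_i=E(X_i)$. *)

(* Defs.v *)
From mathcomp Require Import all_boot all_order all_algebra.
From mathcomp Require Import all_classical all_reals all_analysis.

Set Implicit Arguments.
Unset Strict Implicit.
Unset Printing Implicit Defensive.

Import Order.TTheory GRing.Theory Num.Theory.
Import numFieldNormedType.Exports.

Local Open Scope classical_set_scope.
Local Open Scope ring_scope.

(* R^n is [n.-tuple R], whose measurable sets are the product (= Borel)
   sigma-algebra. *)

Definition componentwise_nondecreasing (R : realType) (n : nat)
    (f : n.-tuple R -> R) : Prop :=
  forall x y : n.-tuple R,
    (forall k : 'I_n, tnth x k <= tnth y k) -> f x <= f y.

Definition componentwise_nonincreasing (R : realType) (n : nat)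
    (f : n.-tuple R -> R) : Prop :=
  forall x y : n.-tuple R,
    (forall k : 'I_n, tnth x k <= tnth y k) -> f y <= f x.

Definition random_vector (R : realType) (T : Type) (n : nat)
    (X : 'I_n -> T -> R) (w : T) : n.-tuple R := [tuple X k w | k < n].

Definition integrable_rv (d : measure_display) (T : measurableType d)
    (R : realType) (P : probability T R) (Y : T -> R) : Prop :=
  P.-integrable [set: T] (EFin \o Y).

(* The covariance of two random variables is defined when both of them and
   their product are integrable. *)
Definition finitely_associated (d : measure_display) (T : measurableType d)
    (R : realType) (P : probability T R) (n : nat) (X : 'I_n -> T -> R) : Prop :=
  forall f g : n.-tuple R -> R,
    measurable_fun [set: n.-tuple R] f ->
    measurable_fun [set: n.-tuple R] g ->
    componentwise_nondecreasing f ->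
    componentwise_nondecreasing g ->
    integrable_rv P (f \o random_vector X) ->
    integrable_rv P (g \o random_vector X) ->
    integrable_rv P ((f \o random_vector X) \* (g \o random_vector X)) ->
    (0 <= covariance P (f \o random_vector X) (g \o random_vector X))%E.

Definition associated (d : measure_display) (T : measurableType d)
    (R : realType) (P : probability T R) (X : nat -> T -> R) : Prop :=
  forall (n : nat) (i : n.-tuple nat), uniq i ->
    finitely_associated P (fun k : 'I_n => X (tnth i k)).

(* Sequences are indexed from 0, so [X i] is the (i+1)-st variable, while
   [partial_sum X n] is the sum of the first n variables. *)
Definition partial_sum (R : realType) (T : Type) (X : nat -> T -> R) (n : nat)
    (w : T) : R := \sum_(i < n) X i w.

(* Times take values in {0, 1, 2, ...} U {oo}, with [None] for oo. *)
Definition time_le (t : option nat) (j : nat) : bool :=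
  if t is Some n then (n <= j)%N else false.

Definition time_ge (t : option nat) (i : nat) : bool :=
  if t is Some n then (i <= n)%N else true.

Definition stopping_time (R : realType) (T : Type)
    (X : nat -> T -> R) (tau : T -> option nat) : Prop :=
  (forall w, time_ge (tau w) 1) /\
  (forall j : nat, (1 <= j)%N ->
     g_sigma_preimage (fun k : 'I_j => partial_sum X k.+1)
       [set w | time_le (tau w) j]).

Definition bounded_time (d : measure_display) (T : measurableType d)
    (R : realType) (P : probability T R) (tau : T -> option nat) : Prop :=
  exists M : nat, {ae P, forall w, time_le (tau w) M}.

(* Its value on {tau = oo} is conventional, and immaterial
   when tau is almost surely finite. *)
Definition stopped_sum (R : realType) (T : Type) (X : nat -> T -> R)
    (tau : T -> option nat) (w : T) : R :=
  if tau w is Some n then partial_sum X n w else 0.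

(* a_1 + ... + a_tau, defined as the series of the a_i I{tau >= i}, i >= 1
   (a_i being [a i.-1]). *)
Definition sum_upto_time (R : realType) (T : Type) (a : nat -> R)
    (tau : T -> option nat) (w : T) : R :=
  limn (series (fun i : nat => a i * \1_[set v | time_ge (tau v) i.+1] w)).

Definition time_indicator_monotone (R : realType) (T : Type)
    (mono : forall n : nat, (n.-tuple R -> R) -> Prop)
    (X : nat -> T -> R) (tau : T -> option nat) : Prop :=
  forall j : nat, (1 <= j)%N ->
    exists h : j.-tuple R -> R,
      [/\ measurable_fun [set: j.-tuple R] h,
          mono j h &
          forall w, \1_[set v | time_le (tau v) j] w =
                    h (random_vector (fun k : 'I_j => partial_sum X k.+1) w)].

(* Main.v *)
Require Import Defs.
From mathcomp Require Import all_boot all_order all_algebra.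
From mathcomp Require Import all_classical all_reals all_analysis.
From mathcomp Require Import measurable_realfun.

Import Order.TTheory GRing.Theory Num.Theory.
Import numFieldNormedType.Exports.

(** When tau <= M almost surely, S_tau = \sum_(i < M) X_i I{tau >= i + 1} almost
    surely (the X_i being numbered from 0), and the sum of the means E(X_i)
    up to tau decomposes in the same way, so that

      E(S_tau) = \sum_(i < M) E(X_i I{tau >= i + 1}),
      E(\sum_(l <= tau) E(X_l)) = \sum_(i < M) E(X_i) P(tau >= i + 1)

    ([expectation_stopped_sum] and [expectation_sum_upto_time]), and it is
    enough to compare these sums term by term.  The i-th terms differ by the
    covariance of X_i and I{tau >= i + 1} = 1 - I{tau <= i}.  Now I{tau <= i} is
    a monotone function of the partial sums of X_0, ..., X_(i-1), hence a
    function of X_0, ..., X_i monotone in the same direction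
    ([time_indicator_of_terms]).  Association of X_0, ..., X_i therefore gives
    the sign of that covariance ([associated_expectation_mul_indic]); it is
    defined since an indicator is bounded and X_i is integrable.

    Random times are split into the countably many events {tau = t}, which
    makes the stopped quantities measurable
    ([measurable_fun_time_cases]); this is needed for the almost sure
    decompositions above to be integrated. *)

Local Open Scope classical_set_scope.
Local Open Scope ring_scope.

(** * Times and partial sums *)

Lemma time_geE (t : option nat) (i : nat) : time_ge t i.+1 = ~~ time_le t i.
Proof. by case: t => [n|//] /=; rewrite ltnNge. Qed.

Lemma setC_time_le (T : Type) (tau : T -> option nat) (i : nat) :
  ~` [set w | time_le (tau w) i] = [set w | time_ge (tau w) i.+1].
Proof. by apply/seteqP; split => w /=; rewrite time_geE => /negP. Qed.

Lemma indic_predE (R : realType) (T : Type) (p : pred T) (w : T) :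
  \1_[set v | p v] w = (p w)%:R :> R.
Proof. by rewrite indicE mem_setE. Qed.

(** The vector of the first [m] partial sums of the coordinates of [x].  Sums
    stop at the last coordinate of [x], so that [partial_sums n m x] has its
    intended meaning for [m <= n]. *)
Definition partial_sums {R : realType} (n m : nat) (x : n.-tuple R) :
    m.-tuple R :=
  [tuple \sum_(l < n | (l < k.+1)%N) tnth x l | k < m].

Lemma measurable_partial_sums (R : realType) (n m : nat) :
  measurable_fun [set: n.-tuple R] (@partial_sums R n m).
Proof.
apply/measurable_fun_tnthP => k.
rewrite (_ : _ \o _ =
    fun x => \sum_(l < n) (if (l < k.+1)%N then tnth x l else 0)); last first.
  by apply/funext => x /=; rewrite tnth_mktuple big_mkcond.
apply: measurable_sum => l; case: (l < k.+1)%N; last exact: measurable_cst.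
exact: measurable_tnth.
Qed.

Lemma partial_sums_le (R : realType) (n m : nat) (x y : n.-tuple R) :
  (forall k, tnth x k <= tnth y k) ->
  forall k, tnth (partial_sums n m x) k <= tnth (partial_sums n m y) k.
Proof. by move=> xy k; rewrite !tnth_mktuple; apply: ler_sum. Qed.

Lemma random_vector_partial_sum (R : realType) (T : Type) (X : nat -> T -> R)
    (n m : nat) (w : T) : (m <= n)%N ->
  random_vector (fun k : 'I_m => partial_sum X k.+1) w =
  partial_sums n m (random_vector (fun k : 'I_n => X k) w).
Proof.
move=> mn; apply: eq_from_tnth => k; rewrite !tnth_mktuple /partial_sum.
rewrite (big_ord_widen n (fun l => X l w)) ?(leq_trans _ mn)//.
by apply: eq_bigr => l _; rewrite tnth_mktuple.
Qed.

(** A time indicator monotone in the partial sums of the first [i] terms is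
    monotone in the first [i.+1] terms.  The [i.+1]-st term is a dummy
    variable, added so that association can be applied to a family containing
    it.  For [i = 0], no monotonicity is assumed of the indicator, but it is
    0 since times are positive. *)
Lemma time_indicator_of_terms (R : realType) (T : Type)
    (mono : forall n : nat, (n.-tuple R -> R) -> Prop)
    (X : nat -> T -> R) (tau : T -> option nat) :
  (forall n, mono n (cst 0)) ->
  (forall n m (h : m.-tuple R -> R),
    mono m h -> mono n (h \o partial_sums n m)) ->
  (forall w, time_ge (tau w) 1) ->
  time_indicator_monotone mono X tau ->
  forall i, exists g : i.+1.-tuple R -> R,
    [/\ measurable_fun [set: i.+1.-tuple R] g, mono i.+1 g &
        forall w, \1_[set v | time_le (tau v) i] w =
                  g (random_vector (fun k : 'I_i.+1 => X k) w)].
Proof.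
move=> mono0 mono_sums tau1 mtau [|i].
  exists (cst 0); split => // w; rewrite indicE memNset//= => tau0.
  by have := tau1 w; rewrite time_geE tau0.
have [//|h [mh monoh tauh]] := mtau i.+1.
exists (h \o partial_sums i.+2 i.+1); split.
- exact: measurableT_comp mh (measurable_partial_sums R i.+2 i.+1).
- exact: mono_sums.
- by move=> w /=; rewrite tauh (random_vector_partial_sum _ _ _ i.+2).
Qed.

(** * Expectations *)

Section expectations.
Context {d : measure_display} {T : measurableType d} {R : realType}.
Context (P : probability T R).

Lemma integrable_rv_measurable (Y : T -> R) :
  integrable_rv P Y -> measurable_fun [set: T] Y.
Proof. by move=> /integrableP[/measurable_EFinP]. Qed.

Lemma integrable_rv_Lfun1 (Y : T -> R) : integrable_rv P Y -> Y \in Lfun P 1.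
Proof. by move=> iY; apply/Lfun1_integrable. Qed.

Lemma integrable_rv_indic (A : set T) :
  measurable A -> integrable_rv P (\1_A : T -> R).
Proof.
by move=> mA; apply: integrable_indic => //; rewrite fin_num_measure.
Qed.

Lemma integrable_rv_mul_indic (Y : T -> R) (A : set T) :
  measurable A -> integrable_rv P Y -> integrable_rv P (Y \* \1_A).
Proof.
move=> mA iY; apply: (le_integrable _ _ _ iY) => //.
  apply/measurable_EFinP/measurable_funM; last exact: measurable_indic.
  exact: integrable_rv_measurable.
move=> w _ /=; rewrite lee_fin normrM ler_piMr// indicE.
by case: (_ \in _) => /=; rewrite ?normr1 ?normr0.
Qed.

Lemma expectation_sum_ord (n : nat) (Y : 'I_n -> T -> R) :
  (forall i, integrable_rv P (Y i)) ->
  ('E_P[fun w => (\sum_(i < n) Y i w)%R] = \sum_(i < n) 'E_P[Y i])%E.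
Proof.
move=> iY; rewrite unlock.
under eq_integral do rewrite -sumEFin.
by rewrite integral_sum.
Qed.

Lemma eq_ae_expectation (Y Z : T -> R) :
  measurable_fun [set: T] Y -> measurable_fun [set: T] Z ->
  {ae P, forall w, Y w = Z w} -> ('E_P[Y] = 'E_P[Z])%E.
Proof.
move=> mY mZ YZ; rewrite unlock; apply: ae_eq_integral => //.
- exact/measurable_EFinP.
- exact/measurable_EFinP.
- by apply: filterS YZ => w /= -> _.
Qed.

(** Association read off a pair made of the coordinate [X i] and the indicator
    of an event that is nondecreasing in the terms up to [X i]. *)
Lemma associated_expectation_mul_indic (X : nat -> {RV P >-> R}) (i : nat)
    (B : set T) (g : i.+1.-tuple R -> R) :
  (forall i, integrable_rv P (X i)) -> associated P X ->
  measurable B -> measurable_fun [set: i.+1.-tuple R] g ->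
  componentwise_nondecreasing g ->
  (forall w, \1_B w = g (random_vector (fun k : 'I_i.+1 => X k) w)) ->
  ('E_P[X i] * P B <= 'E_P[(X i : T -> R) \* \1_B])%E.
Proof.
move=> iX aX mB mg ndg Bg.
have := aX i.+1 (iota_tuple i.+1 0) (iota_uniq _ _)
  (fun x => tnth x ord_max) g.
rewrite (_ : (fun k : 'I_i.+1 => _) = fun k : 'I_i.+1 => X k : T -> R);
  last first.
  by apply/funext => k; rewrite (tnth_nth 0%N) nth_iota.
rewrite (_ : g \o _ = \1_B); last by apply/funext => w /=; rewrite Bg.
rewrite (_ : (fun x => tnth x ord_max) \o _ = X i); last first.
  by apply/funext => w /=; rewrite tnth_mktuple.
have iB := integrable_rv_indic B mB.
have iXB := integrable_rv_mul_indic _ _ mB (iX i).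
move=> /(_ (measurable_tnth _) mg (fun x y xy => xy _) ndg (iX i) iB iXB).
rewrite covarianceE; [|exact: integrable_rv_Lfun1..].
rewrite expectation_indic// sube_ge0//.
by rewrite fin_numM// ?fin_num_measure// expectation_fin_num//;
  exact: integrable_rv_Lfun1.
Qed.

(** * Sums stopped at a random time *)

Section stopped.
Context (X : nat -> {RV P >-> R}) (tau : T -> option nat).
Context (stop_tau : stopping_time X tau).

Lemma measurable_partial_sum (n : nat) :
  measurable_fun [set: T] (partial_sum X n).
Proof. by apply: measurable_sum => l; exact: measurable_funPT. Qed.

Lemma measurable_time_le (j : nat) : measurable [set w | time_le (tau w) j].
Proof.
case: stop_tau => tau1 tauj; case: j => [|j].
  rewrite (_ : [set w | _] = set0)//; apply/seteqP; split => // w /= tau0.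
  by have := tau1 w; rewrite time_geE tau0.
have := tauj j.+1 isT; apply: smallest_sub; first
  exact: sigma_algebra_measurable.
rewrite -bigcup_seq/= => A [k _ [B mB <-]].
exact: measurable_partial_sum.
Qed.

Lemma measurable_time_ge (j : nat) : measurable [set w | time_ge (tau w) j.+1].
Proof. by rewrite -setC_time_le; apply/measurableC/measurable_time_le. Qed.

Lemma measurable_time_eq (t : option nat) : measurable [set w | tau w = t].
Proof.
case: t => [[|n]|].
- rewrite (_ : [set w | _] = [set w | time_le (tau w) 0]).
    exact: measurable_time_le.
  apply/seteqP; split => w /=; first by move=> ->.
  by case: (tau w) => [m|//] /=; rewrite leqn0 => /eqP ->.
- rewrite (_ : [set w | _] =
      [set w | time_le (tau w) n.+1] `&` [set w | time_ge (tau w) n.+1]).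
    apply: measurableI; first exact: measurable_time_le.
    exact: measurable_time_ge.
  apply/seteqP; split => w /=; first by move=> -> /=; rewrite leqnn.
  case: (tau w) => [m|] /= [] // mn nm.
  by congr Some; apply/eqP; rewrite eqn_leq mn.
- rewrite (_ : [set w | _] = ~` \bigcup_n [set w | time_le (tau w) n]).
    by apply/measurableC/bigcup_measurable => n _; exact: measurable_time_le.
  apply/seteqP; split => w /=; first by move=> twN [n _]; rewrite /= twN.
  by case E : (tau w) => [n|//] []; exists n; rewrite //= E /=.
Qed.

(** A function is measurable if it coincides with a measurable function
    [F t] on each event [tau = t]. *)
Lemma measurable_fun_time_cases (f : T -> R) (F : option nat -> T -> R) :
  (forall t, measurable_fun [set: T] (F t)) ->
  (forall w, f w = F (tau w) w) -> measurable_fun [set: T] f.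
Proof.
move=> mF fF.
(* s enumerates the possible values of tau. *)
pose s k : option nat := if k is n.+1 then Some n else None.
have -> : [set: T] = \bigcup_k [set w | tau w = s k].
  apply/seteqP; split => // w _.
  by case E : (tau w) => [n|]; [exists n.+1|exists 0%N].
apply/measurable_fun_bigcup => k; first exact: measurable_time_eq.
apply: (eq_measurable_fun (F (s k))); last exact: measurable_funTS.
by move=> w /set_mem /= <-; rewrite fF.
Qed.

Lemma measurable_stopped_sum : measurable_fun [set: T] (stopped_sum X tau).
Proof.
apply: (@measurable_fun_time_cases _
  (fun t => if t is Some n then partial_sum X n else cst 0)).
  by move=> [n|]; [exact: measurable_partial_sum|exact: measurable_cst].
by move=> w; rewrite /stopped_sum; case: (tau w).
Qed.

Lemma measurable_sum_upto_time (a : nat -> R) :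
  measurable_fun [set: T] (sum_upto_time a tau).
Proof.
apply: (@measurable_fun_time_cases _
  (fun t => cst (limn (series (fun i => a i * (time_ge t i.+1)%:R))))) => // w.
rewrite /sum_upto_time /=; congr (limn (series _)); apply/funext => i.
by rewrite indic_predE.
Qed.

Lemma stopped_sumE (M : nat) (w : T) : time_le (tau w) M ->
  stopped_sum X tau w =
  \sum_(i < M) X i w * \1_[set v | time_ge (tau v) i.+1] w.
Proof.
rewrite /stopped_sum; case E : (tau w) => [n|//] /= nM.
rewrite /partial_sum (big_ord_widen M (fun l => X l w))// big_mkcond/=.
apply: eq_bigr => i _; rewrite indic_predE E /=.
by case: ifP; rewrite (mulr1, mulr0).
Qed.

Lemma sum_upto_timeE (a : nat -> R) (M : nat) (w : T) : time_le (tau w) M ->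
  sum_upto_time a tau w =
  \sum_(i < M) a i * \1_[set v | time_ge (tau v) i.+1] w.
Proof.
move=> tauM; rewrite /sum_upto_time; apply/cvg_lim => //.
(* From index M on, the series has no further nonzero term. *)
apply: cvg_near_cst.
exists M => // n /= Mn; rewrite /series/= -(big_mkord xpredT
  (fun i => a i * \1_[set v | time_ge (tau v) i.+1] w)).
rewrite (big_cat_nat (leq0n M) Mn)/= [X in _ + X]big1_seq ?addr0// => i.
rewrite mem_index_iota => /andP[_ /andP[Mi _]].
rewrite (indic_predE _ _ (fun v => time_ge (tau v) i.+1)) time_geE.
by case: (tau w) tauM => //= m mM; rewrite (leq_trans mM Mi) mulr0.
Qed.

Context (intX : forall i, integrable_rv P (X i)).

Lemma expectation_stopped_sum (M : nat) :
  {ae P, forall w, time_le (tau w) M} ->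
  ('E_P[stopped_sum X tau] =
  \sum_(i < M)
    'E_P[(X i : T -> R) \* \1_[set v | time_ge (tau v) i.+1]])%E.
Proof.
move=> tauM.
have iXt (i : 'I_M) :=
  integrable_rv_mul_indic _ _ (measurable_time_ge i) (intX i).
rewrite -expectation_sum_ord//.
apply: eq_ae_expectation.
- exact: measurable_stopped_sum.
- by apply: measurable_sum => i; exact: integrable_rv_measurable.
- by apply: filterS tauM => w /stopped_sumE.
Qed.

Lemma expectation_sum_upto_time (a : nat -> R) (M : nat) :
  {ae P, forall w, time_le (tau w) M} ->
  ('E_P[sum_upto_time a tau] =
  \sum_(i < M) (a i)%:E * P [set v | time_ge (tau v) i.+1])%E.
Proof.
move=> tauM.
have it i := integrable_rv_indic _ (measurable_time_ge i).
transitivity (\sum_(i < M)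
    'E_P[fun w => (\1_[set v | time_ge (tau v) i.+1] w * a i)%R])%E; last first.
  apply: eq_bigr => i _.
  rewrite expectationZl ?expectation_indic//; last exact: integrable_rv_Lfun1.
  exact: measurable_time_ge.
have ita (i : 'I_M) :
    integrable_rv P (fun w => \1_[set v | time_ge (tau v) i.+1] w * a i).
  exact: (integrableZr measurableT (a i) (it i)).
rewrite -expectation_sum_ord//.
apply: eq_ae_expectation.
- exact: measurable_sum_upto_time.
- by apply: measurable_sum => i; exact: integrable_rv_measurable.
- apply: filterS tauM => w /sum_upto_timeE ->.
  by apply: eq_bigr => i _; rewrite mulrC.
Qed.

End stopped.
End expectations.

(** * Comparison of the expectations *)

Theorem theorem4p5 (d : measure_display) (T : measurableType d) (R : realType)
    (P : probability T R) (X : nat -> {RV P >-> R}) (tau : T -> option nat)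
    (intX : forall i : nat, integrable_rv P (X i))
    (assocX : associated P X)
    (stop_tau : stopping_time X tau)
    (bnd_tau : bounded_time P tau) :
  (time_indicator_monotone (@componentwise_nondecreasing R) X tau ->
   ('E_P[stopped_sum X tau] <=
    'E_P[sum_upto_time (fun i : nat => fine 'E_P[X i]) tau])%E) /\
  (time_indicator_monotone (@componentwise_nonincreasing R) X tau ->
   ('E_P[stopped_sum X tau] >=
    'E_P[sum_upto_time (fun i : nat => fine 'E_P[X i]) tau])%E).
Proof.
have [M tauM] := bnd_tau.
have fX i : ('E_P[X i])%E \is a fin_num.
  by apply: expectation_fin_num; exact: integrable_rv_Lfun1.
have mle i := measurable_time_le P X tau stop_tau i.
have mge i := measurable_time_ge P X tau stop_tau i.
rewrite (expectation_stopped_sum P X tau stop_tau intX M)//.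
rewrite (expectation_sum_upto_time P X tau stop_tau _ M)//.
have [tau1 _] := stop_tau.
split => mtau; apply: lee_sum => i _; rewrite fineK//.
- have ndsums n m (h : m.-tuple R -> R) : componentwise_nondecreasing h ->
      componentwise_nondecreasing (h \o partial_sums n m).
    by move=> ndh x y /(partial_sums_le _ n m); exact: ndh.
  have [g [mg ndg taug]] := time_indicator_of_terms R T
    (@componentwise_nondecreasing R) X tau
    (fun _ _ _ _ => lexx _) ndsums tau1 mtau i.
  (* Association bounds E(X_i I{tau <= i}) from below; passing to the
     complement of {tau <= i} reverses the inequality. *)
  have := associated_expectation_mul_indic P X i _ g intX assocX (mle i)
    mg ndg taug.
  have iXl := integrable_rv_mul_indic _ _ _ (mle i) (intX i).
  rewrite -setC_time_le probability_setC//.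
  rewrite (_ : _ \* \1_(~` _) = (X i : T -> R) \-
      ((X i : T -> R) \* \1_[set w | time_le (tau w) i])); last first.
    apply/funext => w /=; rewrite !indicE in_setC.
    by case: (_ \in _); rewrite /= ?(mulr1, mulr0) ?subrr ?subr0.
  rewrite expectationB; [|exact: integrable_rv_Lfun1..].
  rewrite muleBr ?mule1 ?fin_num_adde_defr// => h.
  by rewrite leeB.
- have nisums n m (h : m.-tuple R -> R) : componentwise_nonincreasing h ->
      componentwise_nonincreasing (h \o partial_sums n m).
    by move=> nih x y /(partial_sums_le _ n m); exact: nih.
  have [g [mg nig taug]] := time_indicator_of_terms R T
    (@componentwise_nonincreasing R) X tau
    (fun _ _ _ _ => lexx _) nisums tau1 mtau i.
  (* I{tau >= i + 1} = 1 - I{tau <= i} is nondecreasing in the terms. *)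
  apply: (associated_expectation_mul_indic P X i _ (fun x => 1 - g x)) => //.
  + exact: measurable_funB.
  + by move=> x y /nig; rewrite lerD2l lerN2.
  + move=> w; rewrite -taug !indicE -setC_time_le in_setC.
    by case: (_ \in _); rewrite /= ?subr0 ?subrr.
Qed.
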